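(* Let $f:\mathbb{N}\to\mathbb{N}$ be a surjective unbounded non-decreasing function. Suppose there exists an integer $M\ge 2$ such that $f(Mn)\le M f(n)$ for all $n\in\mathbb{N}$. Then there exists an elementary amenable lawless group $\Gamma$, generated by a finite set $S$, such that $\mathcal{A}_{\Gamma}^{S}\approx f$.
   Context: $\mathbb{N}=\{1,2,3,\dots\}$. For a group $\Gamma$ and the free group $F_k$ of rank $k$, a nontrivial $w\in F_k$ is a law for $\Gamma$ if $w(g_1,\dots,g_k)=e$ for all $g_1,\dots,g_k\in\Gamma$. $\Gamma$ is lawless if for some $k\ge 2$ (equivalently for all $k\ge1$) it has no law in $F_k$. Let $S$ be a generating set of $\Gamma$, $|\cdot|_S$ the word length on $\Gamma$, and $|\cdot|$ the word length on $F_k$ with respect to a fixed free basis. For a nontrivial $w\in F_k$ that is not a law for $\Gamma$, put $\chi_\Gamma^S(w)=\min\{\sum_{i=1}^k|g_i|_S : g_i\in\Gamma,\ w(g_1,\dots,g_k)\ne e\}$. For $\Gamma$ lawless and a fixed $k\ge 2$, the lawlessness growth is $\mathcal{A}_\Gamma^S(l)=\max\{\chi_\Gamma^S(w): w\in F_k\setminus\{1\},\ |w|\le l\}$ for $l\in\mathbb{N}$; up to the equivalence $\approx$ below it does not depend on the choice of $k\ge2$. For nondecreasing $F_1,F_2:\mathbb{N}\to\mathbb{N}$ write $F_1\preceq F_2$ if there is $K\in\mathbb{N}$ with $F_1(l)\le K F_2(Kl)$ for all $l\in\mathbb{N}$, and $F_1\approx F_2$ if $F_1\preceq F_2$ and $F_2\preceq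 F_1$. The class of elementary amenable groups is the smallest class containing all finite groups and $\mathbb{Z}$ and closed under subgroups, quotients, extensions and directed limits. *)

(* Defs.v *)
From HB Require Import structures.
From mathcomp Require Import all_boot all_order ssralg ssrint.
From mathcomp Require Import boolp classical_sets functions cardinality.

Set Implicit Arguments.
Unset Strict Implicit.
Unset Printing Implicit Defensive.

Local Open Scope classical_set_scope.
Local Open Scope group_scope.

(* Minimum and maximum of a set of natural numbers; the junk value 0 is
   returned when they do not exist. *)
Definition nat_min (E : set nat) : nat := xget 0%N (E `&` lbound E).
Definition nat_max (E : set nat) : nat := xget 0%N (E `&` ubound E).

(* The free group of rank k, as the group of reduced words over the letters
   x_i = (i, false) and x_i^-1 = (i, true). *)
Section FreeGroup.
Variable k : nat.

Definition letter : Type := ('I_k * bool)%type.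

Definition flip (x : letter) : letter := (x.1, ~~ x.2).

Definition reduced (s : seq letter) : bool :=
  sorted (fun x y => y != flip x) s.

Definition push (x : letter) (s : seq letter) : seq letter :=
  if s is y :: s' then if y == flip x then s' else x :: s else [:: x].

Lemma flipK : involutive flip.
Proof. by case=> i b; rewrite /flip negbK. Qed.

Lemma reduced_push x s : reduced s -> reduced (push x s).
Proof.
by case: s => [|y s] //= ys; case: eqP => [_|/eqP ynx] /=;
  [exact: path_sorted ys | rewrite ynx].
Qed.

Lemma push_flip x s : reduced s -> push x (push (flip x) s) = s.
Proof.
case: s => [|y s] /=; first by rewrite eqxx.
rewrite flipK; case: eqP => [-> {y}|_ _] /=; last by rewrite eqxx.
by case: s => [|z s] //= /andP[/negPf->].
Qed.

Lemma reduced_foldr u s : reduced s -> reduced (foldr push s u).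
Proof. by move=> rs; elim: u => //= x u; exact: reduced_push. Qed.

Lemma foldr_push x u s : reduced s ->
  foldr push s (push x u) = push x (foldr push s u).
Proof.
move=> rs; case: u => [|y u] //=; case: eqP => // ->.
by rewrite push_flip// reduced_foldr.
Qed.

Lemma foldr_reduce u v s : reduced s ->
  foldr push s (foldr push v u) = foldr push (foldr push s v) u.
Proof. by move=> rs; elim: u => //= x u IHu; rewrite foldr_push// IHu. Qed.

Lemma foldr_nil u : reduced u -> foldr push [::] u = u.
Proof.
elim: u => [//|x u IHu] /= xu; rewrite IHu; last exact: path_sorted xu.
by case: u xu {IHu} => [//|y u] /= /andP[/negPf->].
Qed.

Definition free_group : Type := {s : seq letter | reduced s}.
HB.instance Definition _ := Choice.on free_group.

Definition free_one : free_group := exist _ [::] isT.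

Definition free_mul (u v : free_group) : free_group :=
  exist _ (foldr push (val v) (val u)) (reduced_foldr _ (valP v)).

Lemma reduced_inv s : reduced s -> reduced (rev (map flip s)).
Proof.
rewrite /reduced rev_sorted sorted_map; apply: sub_sorted => x y /=.
by apply: contra; rewrite flipK => /eqP->.
Qed.

Definition free_inv (u : free_group) : free_group :=
  exist _ (rev (map flip (val u))) (reduced_inv (valP u)).

Lemma free_mulA : associative free_mul.
Proof. by move=> u v w; apply: val_inj; rewrite /= foldr_reduce// (valP w). Qed.

Lemma free_mul1 : left_id free_one free_mul.
Proof. by move=> u; apply: val_inj. Qed.

Lemma free_1mul : right_id free_one free_mul.
Proof. by move=> u; apply: val_inj; rewrite /= foldr_nil// (valP u). Qed.

Lemma foldr_inv u s : reduced s ->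
  foldr push (foldr push s u) (rev (map flip u)) = s.
Proof.
elim: u s => //= x u IHu s rs; rewrite rev_cons -cats1 foldr_cat /=.
have rt := reduced_foldr u rs.
by have := push_flip (flip x) rt; rewrite flipK => ->; exact: IHu.
Qed.

Lemma free_mulV : left_inverse free_one free_inv free_mul.
Proof.
move=> u; apply: val_inj => /=.
by rewrite -{1}(foldr_nil (valP u)) foldr_inv.
Qed.

Lemma free_invK : involutive free_inv.
Proof.
move=> u; apply: val_inj; rewrite /= map_rev revK -map_comp.
by rewrite (eq_map (g := id)) ?map_id// => x /=; rewrite flipK.
Qed.

Lemma free_Vmul : right_inverse free_one free_inv free_mul.
Proof. by move=> u; rewrite -{1}(free_invK u) free_mulV. Qed.

HB.instance Definition _ := isGroup.Build free_group
  free_mulA free_mul1 free_1mul free_mulV free_Vmul.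

Definition free_length (w : free_group) : nat := size (val w).

Definition letter_eval (G : groupType) (g : 'I_k -> G) (x : letter) : G :=
  if x.2 then (g x.1)^-1 else g x.1.

Definition free_eval (G : groupType) (g : 'I_k -> G) (w : free_group) : G :=
  \prod_(x <- val w) letter_eval g x.

Definition free_gen (i : 'I_k) : free_group := exist _ [:: (i, false)] isT.

Lemma free_eval_gen (G : groupType) (g : 'I_k -> G) i :
  free_eval g (free_gen i) = g i.
Proof. by rewrite /free_eval big_seq1. Qed.

Lemma letter_eval_flip (G : groupType) (g : 'I_k -> G) x :
  letter_eval g (flip x) = (letter_eval g x)^-1.
Proof. by case: x => i [] //=; rewrite /letter_eval /= invgK. Qed.

Lemma free_evalM (G : groupType) (g : 'I_k -> G) :
  {morph free_eval g : u v / u * v >-> u * v}.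
Proof.
move=> u v; rewrite /free_eval /=; elim: (val u) => [|x s IHs] /=.
  by rewrite big_nil mul1g.
rewrite big_cons -mulgA -{}IHs.
case: (foldr _ _ _) => [|y t] /=; first by rewrite big_seq1 big_nil mulg1.
by case: eqP => [->|_]; rewrite !big_cons// letter_eval_flip mulgA mulgV mul1g.
Qed.
End FreeGroup.

Definition is_law (G : groupType) k (w : free_group k) : Prop :=
  forall g : 'I_k -> G, free_eval g w = 1.

Definition lawless (G : groupType) : Prop :=
  exists2 k, (2 <= k)%N & forall w : free_group k, w != 1 -> ~ is_law G w.

Section Growth.
Variables (G : groupType) (S : set G).

Definition word_on (s : seq G) : Prop :=
  forall x, x \in s -> S x \/ S x^-1.

Definition generates : Prop :=
  forall g : G, exists2 s, word_on s & \prod_(x <- s) x = g.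

Definition word_length (g : G) : nat :=
  nat_min [set size s | s in [set s | word_on s /\ \prod_(x <- s) x = g]].

Definition complexity k (w : free_group k) : nat :=
  nat_min [set (\sum_(i < k) word_length (g i))%N |
             g in [set g : 'I_k -> G | free_eval g w != 1]].

Definition lawlessness_growth k (l : nat) : nat :=
  nat_max [set complexity w |
             w in [set w : free_group k | w != 1 /\ (free_length w <= l)%N]].
End Growth.

(* Functions from {1, 2, 3, ...} to itself are represented by functions on nat,
   whose value at 0 is irrelevant. *)
Definition posn : set nat := [set n | (0 < n)%N].

Definition growth_le (F1 F2 : nat -> nat) : Prop :=
  exists2 K, (0 < K)%N & forall l, (0 < l)%N -> (F1 l <= K * F2 (K * l))%N.

Definition growth_equiv (F1 F2 : nat -> nat) : Prop :=
  growth_le F1 F2 /\ growth_le F2 F1.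

Record directed_system (I : Type) (le : I -> I -> Prop) (G_ : I -> groupType)
    (t : forall i j, le i j -> {multiplicative G_ i -> G_ j}) : Prop := {
  ds_inhabited : inhabited I;
  ds_refl : forall i, le i i;
  ds_trans : forall i j k, le i j -> le j k -> le i k;
  ds_directed : forall i j, exists2 k, le i k & le j k;
  ds_id : forall i (ii : le i i) x, t i i ii x = x;
  ds_comp : forall i j k (ij : le i j) (jk : le j k) (ik : le i k) x,
    t j k jk (t i j ij x) = t i k ik x }.

Definition cocone (I : Type) (le : I -> I -> Prop) (G_ : I -> groupType)
    (t : forall i j, le i j -> {multiplicative G_ i -> G_ j})
    (L : groupType) (phi : forall i, {multiplicative G_ i -> L}) : Prop :=
  forall i j (ij : le i j) x, phi j (t i j ij x) = phi i x.

Definition is_colimit (I : Type) (le : I -> I -> Prop) (G_ : I -> groupType)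
    (t : forall i j, le i j -> {multiplicative G_ i -> G_ j})
    (L : groupType) (phi : forall i, {multiplicative G_ i -> L}) : Prop :=
  cocone t phi /\
  forall (H : groupType) (psi : forall i, {multiplicative G_ i -> H}),
    cocone t psi ->
    (exists h : {multiplicative L -> H}, forall i x, h (phi i x) = psi i x) /\
    (forall h h' : {multiplicative L -> H},
       (forall i x, h (phi i x) = psi i x) ->
       (forall i x, h' (phi i x) = psi i x) -> h =1 h').

(* Subgroups and quotients are taken up to isomorphism, as sources of injective
   and targets of surjective homomorphisms. *)
Inductive elementary_amenable : groupType -> Prop :=
| EA_finite (G : groupType) : finite_set [set: G] -> elementary_amenable G
| EA_int (G : groupType) (e : int -> G) :
    bijective e -> {morph e : m n / (m + n)%R >-> m * n} ->
    elementary_amenable G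
| EA_subgroup (H G : groupType) (i : {multiplicative H -> G}) :
    injective i -> elementary_amenable G -> elementary_amenable H
| EA_quotient (G Q : groupType) (p : {multiplicative G -> Q}) :
    (forall y, exists x, p x = y) ->
    elementary_amenable G -> elementary_amenable Q
| EA_extension (N G Q : groupType) (i : {multiplicative N -> G})
    (p : {multiplicative G -> Q}) :
    injective i -> (forall y, exists x, p x = y) ->
    (forall x, p x = 1 <-> exists y, i y = x) ->
    elementary_amenable N -> elementary_amenable Q -> elementary_amenable G
| EA_limit (I : Type) (le : I -> I -> Prop) (G_ : I -> groupType)
    (t : forall i j, le i j -> {multiplicative G_ i -> G_ j})
    (L : groupType) (phi : forall i, {multiplicative G_ i -> L}) :
    directed_system t -> is_colimit t phi ->
    (forall i, elementary_amenable (G_ i)) -> elementary_amenable L.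

(* Main.v *)
(** At level [j] let [H_j] be the group of invertible [2^j x 2^j] matrices over
    [F_2] and let [r_j = f (2^j)].  The group is generated by the shift [t] of
    the integers and by one lamp configuration which, at level [j], carries the
    [i]-th letter of an alphabet of unitriangular involutions at position
    [i r_j].

    Unitriangular matrices of size [2^j] have exponent [2^j], whereas a word
    of length less than [2^j] in the involutions, without equal consecutive
    letters, is nontrivial for some choice of the involutions (it has a corner
    entry 1).  Translating the lamp configuration by multiples of [r_j] brings
    all the letters to position 0, so tuples of length [O(r_j)] violate every
    word of length [O(2^j)].  Conversely, translates by less than [r_j / 2]
    commute at level [j]: they light at most one lamp at each position.  Hence a
    commutator of two commutators of short elements is trivial at all levels
    beyond some [J], and its [2^J]-th power is trivial everywhere, which is a
    word of length [16 * 2^J].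

    The same sparseness shows that finitely many translates generate a finite
    group; so the kernel of the map to the integers is locally finite. *)

Require Import Defs.
From HB Require Import structures.
From mathcomp Require Import all_boot all_order all_algebra.
From mathcomp Require Import fingroup.
From mathcomp Require Import boolp classical_sets functions cardinality.
From mathcomp Require Import zify.

Set Implicit Arguments.
Unset Strict Implicit.
Unset Printing Implicit Defensive.

Local Open Scope classical_set_scope.
Local Open Scope group_scope.
Import Order.TTheory GRing.Theory Num.Theory.

(** * Unitriangular matrices over F_2 *)

Section Unitriangular.
Variable n : nat.
Local Open Scope ring_scope.
Local Notation mat := 'M['F_2]_n.+1.
Import GRing.Theory.

Definition unitri (A : mat) : Prop :=
  forall a b : 'I_n.+1, (a <= b)%N -> A a b = (a == b)%:R.

Lemma unitri1 : unitri 1.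
Proof. by move=> a b _; rewrite mxE. Qed.

Lemma unitriM A B : unitri A -> unitri B -> unitri (A * B).
Proof.
move=> uA uB a b ab; rewrite mxE (bigD1 a)//= uA// eqxx mul1r uB//.
rewrite big1 ?addr0// => c ca; have [ac|ca'] := leqP a c.
  by rewrite uA// eq_sym (negPf ca) mul0r.
rewrite (uB c b); last by lia.
by rewrite -val_eqE /= ltn_eqF ?mulr0//; lia.
Qed.

(** By Cayley-Hamilton [(A - 1) ^+ n.+1 = 0], and in characteristic 2 the power [2 ^ j] of
    [(A - 1) + 1] is computed termwise. *)
Lemma unitri_exp A j : (n < 2 ^ j)%N -> unitri A -> A ^+ (2 ^ j) = 1.
Proof.
move=> nj uA.
have trigA : is_trig_mx A.
  by apply/is_trig_mxP => a b ab; rewrite uA ?(ltnW ab)// -val_eqE /= ltn_eqF.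
have := Cayley_Hamilton A; rewrite char_poly_trig//.
rewrite (eq_bigr (fun=> ('X - 1%:P))); last first.
  by move=> i _; rewrite uA// eqxx.
rewrite prodr_const card_ord rmorphXn rmorphB /= horner_mx_X horner_mx_C => A0.
have B0 : (A - 1) ^+ (2 ^ j) = 0.
  by rewrite -(subnK nj) exprD A0 mulr0.
have two : 2%N \in [pchar mat].
  rewrite inE /= -(rmorph_nat (@scalar_mx 'F_2 n.+1)) (_ : 2%:R = 0) ?raddf0//.
  exact/eqP.
have sqD (B : mat) : (B + 1) ^+ 2 = B ^+ 2 + 1.
  rewrite !expr2 mulrDl mulrDr mulr1 mul1r addrA -(addrA (B * B)).
  by rewrite (addrr_pchar2 two) addr0.
have step (B : mat) m : (B + 1) ^+ (2 ^ m) = B ^+ (2 ^ m) + 1.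
  by elim: m => [//|m IHm]; rewrite expnSr !exprM IHm sqD.
by rewrite -[A](subrK 1) step B0 add0r.
Qed.

(* The condition [u a != i] makes [letter_nil u i] square to zero. *)
Definition letter_nil (u : 'I_n.+1 -> nat) (i : nat) : mat :=
  \matrix_(a, b) [&& a == b.+1 :> nat, u b == i & u a != i]%:R.

Definition letter_mx (u : 'I_n.+1 -> nat) (i : nat) : mat :=
  1 + letter_nil u i.

Lemma letter_nil_sq u i : letter_nil u i * letter_nil u i = 0.
Proof.
apply/matrixP => a b; rewrite !mxE big1// => c _; rewrite !mxE -natrM mulnb.
by case: (u c == i); rewrite !(andbF, andFb).
Qed.

Lemma unitri_letter u i : unitri (letter_mx u i).
Proof.
move=> a b ab; rewrite !mxE (_ : (a == b.+1 :> nat) = false) ?addr0//.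
by apply/eqP; lia.
Qed.

Lemma letter_mx_sq u i : letter_mx u i * letter_mx u i = 1.
Proof.
rewrite /letter_mx mulrDl mul1r mulrDr mulr1 letter_nil_sq addr0 -addrA.
rewrite (_ : letter_nil u i + _ = 0) ?addr0//.
by apply/matrixP => a b; rewrite !mxE (@addrr_pchar2 'F_2) ?pchar_Fp.
Qed.

(* Reading the distinct consecutive letters of [s] along the subdiagonal leaves
   a single path from row [size s] to column 0. *)
Lemma prod_letter_entry (u : 'I_n.+1 -> nat) (s : seq nat) :
  (size s <= n)%N ->
  (forall b : 'I_n.+1, (b < size s)%N -> u b = nth 0%N (rev s) b) ->
  (forall b : 'I_n.+1, b = size s :> nat -> u b != head (u b).+1 s) ->
  sorted (fun x y => x != y) s ->
  forall b : 'I_n.+1, (size s <= b)%N ->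
  (\prod_(i <- s) letter_mx u i) b ord0 = (b == size s :> nat)%:R.
Proof.
elim: s => [|i s IHs] sn us uh ss b sb; first by rewrite big_nil mxE.
rewrite big_cons mulrDl mul1r /=.
have {}IHs : forall c : 'I_n.+1, (size s <= c)%N ->
    (\prod_(i <- s) letter_mx u i) c ord0 = (c == size s :> nat)%:R.
  apply: IHs (path_sorted ss) => [|c cs|c cs]; first exact: ltnW.
    by rewrite us ?rev_cons ?nth_rcons ?size_rev ?cs//= ltnS ltnW.
  (* Row [size s] carries [i], which differs from the head of [s]; for empty [s] the default
     [(u c).+1] makes the condition void. *)
  rewrite us /= ?cs// rev_cons nth_rcons size_rev ltnn eqxx.
  case: s ss {us uh sn sb cs} => [_|j s] /=; last by case/andP.
  by rewrite neq_ltn ltnSn.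
(* In [(1 + N) P], with [N] the letter [i] and [P] the product over [s], the summand [P] vanishes
   since [b > size s]; in [N P] only the inner index [size s] can contribute. *)
rewrite mxE IHs ?(ltnW sb)// gtn_eqF// add0r mxE.
have pn : (size s < n.+1)%N by exact: ltnW.
rewrite (bigD1 (Ordinal pn))//= [X in _ + X]big1 ?addr0 => [|c cs].
  rewrite IHs //= eqxx mulr1 mxE /=.
  case: eqP => //= bs; rewrite us //= rev_cons nth_rcons size_rev ltnn !eqxx.
  by rewrite uh.
rewrite mxE; case: eqP => /= [bc|_]; last by rewrite mul0r.
rewrite IHs; last by move: sb => /=; lia.
by move: cs; rewrite -val_eqE /= => /negPf->; rewrite mulr0.
Qed.

End Unitriangular.

(** * Subgroups and elementary amenability *)

Definition mk_mult (G H : groupType) (f : G -> H)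
    (fM : {morph f : x y / x * y}) : {multiplicative G -> H} :=
  HB.pack f (isMultiplicative.Build G H f fM).

Record subgroup (G : groupType) := Subgroup {
  sg_mem :> G -> Prop;
  sg_closed : group_closed (fun x => `[< sg_mem x >]) }.

Definition sg_type (G : groupType) (A : subgroup G) : Type :=
  {x : G | `[< A x >]}.

HB.instance Definition _ (G : groupType) (A : subgroup G) :=
  SubChoice.on (sg_type A).
HB.instance Definition _ (G : groupType) (A : subgroup G) :=
  SubChoice_isSubGroup.Build G (fun x => `[< A x >]) (sg_type A) (sg_closed A).

Section Subgroups.
Variable G : groupType.
Implicit Types A B : subgroup G.

Lemma sg1 A : A 1. Proof. exact/asboolP/(sg_closed A).1. Qed.

Lemma sgF A x y : A x -> A y -> A (x / y).
Proof. by move=> Ax Ay; apply/asboolP/(sg_closed A).2; exact/asboolP. Qed.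

Lemma sgV A x : A x -> A x^-1.
Proof. by move=> Ax; rewrite -(mul1g x^-1); apply: sgF Ax; exact: sg1. Qed.

Lemma sgM A x y : A x -> A y -> A (x * y).
Proof. by move=> Ax Ay; rewrite -(invgK y); apply: sgF Ax _; exact: sgV. Qed.

Definition sg_sub A x (Ax : A x) : sg_type A := exist _ x (asboolT Ax).

Lemma sg_valP A (x : sg_type A) : A (val x).
Proof. exact/asboolP/(valP x). Qed.

Definition sg_incl A B (AB : forall x, A x -> B x) (x : sg_type A) :
  sg_type B := sg_sub (AB _ (sg_valP x)).

Lemma sg_inclM A B (AB : forall x, A x -> B x) :
  {morph sg_incl AB : x y / x * y}.
Proof. by move=> x y; apply/val_inj. Qed.

Lemma sg_incl_inj A B (AB : forall x, A x -> B x) : injective (sg_incl AB).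
Proof. by move=> x y /(congr1 val) /= /val_inj. Qed.

(** An increasing union is the colimit of its terms under the inclusions. *)
Lemma EA_directed_union (F : nat -> subgroup G) A :
  (forall n x, F n x -> A x) -> (forall x, A x -> exists n, F n x) ->
  (forall m n, (m <= n)%N -> forall x, F m x -> F n x) ->
  (forall n, elementary_amenable (sg_type (F n))) ->
  elementary_amenable (sg_type A).
Proof.
move=> FA AF Fmono EAF.
pose t m n (mn : (m <= n)%N) := mk_mult (sg_inclM (Fmono m n mn)).
pose phi n := mk_mult (sg_inclM (FA n)).
apply: (@EA_limit nat (fun m n => m <= n)%N _ t _ phi) => //.
  split => //.
  - exact: (inhabits 0%N).
  - by move=> i j k; exact: leq_trans.
  - by move=> i j; exists (maxn i j); [exact: leq_maxl | exact: leq_maxr].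
  - by move=> i ii x; apply/val_inj.
  - by move=> i j k ij jk ik x; apply/val_inj.
split; first by move=> i j ij x; apply/val_inj.
move=> H psi co; split; last first.
  move=> h h' hP h'P x; have [n Fx] := AF _ (sg_valP x).
  have -> : x = phi n (sg_sub Fx) by exact/val_inj.
  by rewrite hP h'P.
have psi_eq m n x (Fm : F m x) (Fn : F n x) :
    psi m (sg_sub Fm) = psi n (sg_sub Fn).
  wlog mn : m n Fm Fn / (m <= n)%N.
    by move=> W; have [/W->//|/ltnW/W] := leqP m n.
  by rewrite -(co _ _ mn); congr (psi n _); exact/val_inj.
(* The induced map uses a chosen level containing [x]; by [psi_eq] the choice does not matter. *)
pose rk (x : sg_type A) := cid (AF _ (sg_valP x)).
pose h x := psi (sval (rk x)) (sg_sub (svalP (rk x))).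
have hE n (x : sg_type A) (Fx : F n (val x)) : h x = psi n (sg_sub Fx).
  exact: psi_eq.
have hM : {morph h : x y / x * y}.
  move=> x y; have [m Fx] := AF _ (sg_valP x); have [n Fy] := AF _ (sg_valP y).
  have Fx' := Fmono _ _ (leq_maxl m n) _ Fx.
  have Fy' := Fmono _ _ (leq_maxr m n) _ Fy.
  rewrite (hE _ _ Fx') (hE _ _ Fy') (hE _ (x * y) (sgM Fx' Fy')) -gmulfM.
  by congr (psi _ _); exact/val_inj.
exists (mk_mult hM) => i x.
have Fx : F i (val (phi i x)) by exact: sg_valP.
by rewrite /= (hE _ _ Fx); congr (psi i _); exact/val_inj.
Qed.

Lemma EA_finite_subgroup A : finite_set [set x | A x] ->
  elementary_amenable (sg_type A).
Proof.
move=> fA; apply: EA_finite.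
have -> : [set: sg_type A] = (val : sg_type A -> G) @^-1` [set x | A x].
  by apply/seteqP; split => // x _; exact: sg_valP.
by apply: finite_preimage => // x y _ _; exact: val_inj.
Qed.

End Subgroups.

Definition zgroup : Type := int.
HB.instance Definition _ := Choice.on zgroup.
Section ZGroup.
Import GRing.Theory.
HB.instance Definition _ := isGroup.Build zgroup
  (@addrA int) (@add0r int) (@addr0 int) (@addNr int) (@addrN int).
End ZGroup.

Lemma EA_zgroup : elementary_amenable zgroup.
Proof. by apply: (@EA_int zgroup id) => //; exists id. Qed.

(** * Word length and the law *)

(** Well-ordering supplies a genuine minimum, so [xget] does not fall back on 0. *)
Lemma nat_minP (E : set nat) n : E n -> E (nat_min E) /\ (nat_min E <= n)%N.
Proof.
move=> En; have exE : exists n, `[< E n >] by exists n; exact/asboolP.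
case: (ex_minnP exE) => m /asboolP Em mP.
have mlb : (E `&` lbound E) m.
  by split=> // p Ep; rewrite leEnat; apply: mP; exact/asboolP.
rewrite /nat_min; case: xgetP => [p _ [Ep pE]|/(_ _ mlb)//].
by split; last exact: pE.
Qed.

Lemma nat_max_le (E : set nat) B : (forall n, E n -> (n <= B)%N) ->
  (nat_max E <= B)%N.
Proof. by move=> EB; rewrite /nat_max; case: xgetP => // p _ [/EB]. Qed.

Lemma le_nat_max (E : set nat) B n : (forall n, E n -> (n <= B)%N) -> E n ->
  (n <= nat_max E)%N.
Proof.
move=> EB En; have exE : exists n, `[< E n >] by exists n; exact/asboolP.
have bE p : `[< E p >] -> (p <= B)%N by move=> /asboolP; exact: EB.
case: (ex_maxnP exE bE) => m /asboolP Em mP.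
have mub : (E `&` ubound E) m.
  by split=> // p Ep; rewrite leEnat; apply: mP; exact/asboolP.
by rewrite /nat_max; case: xgetP => [p _ [Ep pE]|/(_ _ mub)//]; exact: pE.
Qed.

Section WordLength.
Variables (G : groupType) (S : set G).

Definition inv_word (s : seq G) := [seq x^-1 | x <- rev s].

Lemma prod_inv_word s : \prod_(x <- inv_word s) x = (\prod_(x <- s) x)^-1.
Proof.
elim: s => [|x s IHs]; first by rewrite !big_nil invg1.
by rewrite /inv_word rev_cons map_rcons big_rcons big_cons invgM IHs.
Qed.

Lemma word_on_cat s s' : word_on S s -> word_on S s' -> word_on S (s ++ s').
Proof. by move=> sS s'S x; rewrite mem_cat => /orP[/sS|/s'S]. Qed.

Lemma word_on_inv s : word_on S s -> word_on S (inv_word s).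
Proof.
by move=> sS x /mapP[y]; rewrite mem_rev => /sS[] yS ->; rewrite invgK; tauto.
Qed.

Lemma word_length_le s : word_on S s ->
  (word_length S (\prod_(x <- s) x) <= size s)%N.
Proof. by move=> sS; apply: (nat_minP _).2; exists s. Qed.

Lemma word_lengthP g : generates S -> exists s,
  [/\ word_on S s, \prod_(x <- s) x = g & size s = word_length S g].
Proof.
move=> /(_ g)[s sS sg].
have [|[s' [s'S s'g] s'l] _] :=
  @nat_minP [set size s | s in [set s | word_on S s /\ \prod_(x <- s) x = g]]
    (size s).
  by exists s.
by exists s'.
Qed.

End WordLength.

Section LawWord.
Variables (k : nat) (i0 i1 : 'I_k).
Hypothesis i01 : i0 != i1.
Let x : letter k := (i0, false).
Let y : letter k := (i1, false).

(* The word [c d c^-1 d^-1] with [c = x y x^-1 y^-1] and [d = x^-1 y^-1 x y],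
   a choice for which it is cyclically reduced. *)
Definition law_core : seq (letter k) :=
  [:: x; y; flip x; flip y; flip x; flip y; x; y;
      y; x; flip y; flip x; flip y; flip x; y; x].

(** Successive copies of [law_core] meet in [x x], so nothing cancels at the seams. *)
Lemma reduced_law n : reduced (flatten (nseq n law_core)).
Proof.
have i10 : i1 != i0 by rewrite eq_sym.
elim: n => [//|[|n] IHn]; rewrite /reduced /= !xpair_eqE.
  by rewrite !(negPf i01) !(negPf i10) !eqxx.
rewrite /= !xpair_eqE in IHn *.
by rewrite !(negPf i01) !(negPf i10) !eqxx /= in IHn *.
Qed.

Definition law_word n : free_group k :=
  exist (@reduced k) _ (reduced_law n).

Lemma law_word_length n : free_length (law_word n) = (16 * n)%N.
Proof.
rewrite /free_length /=; elim: n => [//|n IHn].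
by rewrite /= in IHn *; rewrite IHn; lia.
Qed.

Lemma law_word_neq1 n : (0 < n)%N -> law_word n != 1.
Proof.
move=> n0; apply/eqP => /(congr1 (@free_length k)); rewrite law_word_length.
by apply/eqP; rewrite muln_eq0 -lt0n n0.
Qed.

Definition comm2 (G : groupType) (a b : G) : G :=
  let c := a * b * a^-1 * b^-1 in let d := a^-1 * b^-1 * a * b in
  c * d * c^-1 * d^-1.

Lemma law_word_eval (G : groupType) (g : 'I_k -> G) n :
  free_eval g (law_word n) = comm2 (g i0) (g i1) ^+ n.
Proof.
rewrite /free_eval /=; elim: n => [|n IHn]; first by rewrite big_nil expg0.
have -> : flatten (nseq n.+1 law_core) = law_core ++ flatten (nseq n law_core).
  by [].
rewrite big_cat IHn expgS.
congr (_ * _); rewrite /law_core !big_cons big_nil /letter_eval /= mulg1.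
by rewrite /comm2 !invgM !invgK !mulgA.
Qed.

End LawWord.

(** * The lamplighter-type group *)

Section Wreath.
Variables (U : nat -> finType) (H : nat -> finGroupType).

(** The integers acting by simultaneous translation on the unrestricted product of copies of [H j],
    one for each level [j], parameter [u] and position. The parameters keep all choices of the
    involutions side by side. *)
Definition wreath : Type := ((forall j, U j -> int -> H j) * int)%type.
HB.instance Definition _ := gen_eqMixin wreath.
HB.instance Definition _ := gen_choiceMixin wreath.

Definition wreath_one : wreath := (fun j u z => 1, 0%R).
Definition wreath_mul (x y : wreath) : wreath :=
  (fun j u z => x.1 j u z * y.1 j u (z - x.2)%R, (x.2 + y.2)%R).
Definition wreath_inv (x : wreath) : wreath :=
  (fun j u z => (x.1 j u (z + x.2)%R)^-1, (- x.2)%R).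

Lemma wreath_eq (x y : wreath) :
  (forall j u z, x.1 j u z = y.1 j u z) -> x.2 = y.2 -> x = y.
Proof.
case: x y => [x m] [y n] /= xy ->; congr pair.
by apply/functional_extensionality_dep => j; apply/funext => u; apply/funext.
Qed.

Lemma wreath_mulA : associative wreath_mul.
Proof.
move=> x y z; apply: wreath_eq => [j u i|] /=; last exact: addrA.
by rewrite mulgA opprD addrA.
Qed.

Lemma wreath_mul1 : left_id wreath_one wreath_mul.
Proof.
by move=> x; apply: wreath_eq => [j u i|] /=; rewrite ?add0r// mul1g subr0.
Qed.

Lemma wreath_1mul : right_id wreath_one wreath_mul.
Proof.
by move=> x; apply: wreath_eq => [j u i|] /=; rewrite ?addr0// mulg1.
Qed.

Lemma wreath_mulV : left_inverse wreath_one wreath_inv wreath_mul.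
Proof.
move=> x; apply: wreath_eq => [j u i|] /=; last exact: addNr.
by rewrite opprK mulVg.
Qed.

Lemma wreath_Vmul : right_inverse wreath_one wreath_inv wreath_mul.
Proof.
move=> x; apply: wreath_eq => [j u i|] /=; last exact: addrN.
by rewrite subrK mulgV.
Qed.

HB.instance Definition _ := isGroup.Build wreath
  wreath_mulA wreath_mul1 wreath_1mul wreath_mulV wreath_Vmul.

Lemma wreath_lampM (x y : wreath) j u z :
  (x * y).1 j u z = x.1 j u z * y.1 j u (z - x.2)%R.
Proof. by []. Qed.
Lemma wreath_shiftM (x y : wreath) : (x * y).2 = (x.2 + y.2)%R.
Proof. by []. Qed.
Lemma wreath_shiftV (x : wreath) : (x^-1).2 = (- x.2)%R.
Proof. by []. Qed.

(** * Sparse lamp configurations *)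

Variables (gen : forall j, U j -> nat -> H j) (r : nat -> nat).
Hypothesis gen_sq : forall j u i, gen u i * gen u i = 1 :> H j.
Hypothesis gen_large :
  forall j u i, (2 ^ j < i)%N -> gen u i = 1 :> H j.
Hypothesis r_gt0 : forall j, (0 < r j)%N.

Definition lamp_gen j (u : U j) (z : int) : H j :=
  if z is Posz k then if (r j %| k)%N then gen u (k %/ r j)%N else 1 else 1.

Lemma lamp_gen_sq j (u : U j) z : lamp_gen u z * lamp_gen u z = 1.
Proof. by case: z => k /=; [case: ifP; rewrite ?mulg1|rewrite mulg1]. Qed.

Lemma lamp_gen_mul j (u : U j) i : lamp_gen u (i * r j)%N = gen u i.
Proof. by rewrite /= dvdn_mull// mulnK. Qed.

Lemma lamp_gen_bounded j (u : U j) z :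
  lamp_gen u z != 1 -> (0 <= z)%R && (z <= (2 ^ j * r j)%N)%R.
Proof.
case: z => k /=; last by rewrite eqxx.
case: ifP; rewrite ?eqxx// => rk; rewrite lez_nat; apply: contraNT.
by rewrite -ltnNge => kbig; rewrite gen_large// ltn_divRL.
Qed.

(** Both [z - m] and [z - m'] are multiples of [r j], and they differ by at most [2 * M < r j]. *)
Lemma lamp_gen_sparse j (u : U j) z m m' M :
  (2 * M < r j)%N -> (`|m| <= M)%N -> (`|m'| <= M)%N ->
  lamp_gen u (z - m)%R != 1 -> lamp_gen u (z - m')%R != 1 -> m = m'.
Proof.
move=> Mr mM mM'.
case E : (z - m)%R => [k|k] /=; last by rewrite eqxx.
case E' : (z - m')%R => [k'|k'] /=; last by rewrite eqxx.
case: ifP; rewrite ?eqxx// => /dvdnP[q kq] _.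
case: ifP; rewrite ?eqxx// => /dvdnP[q' kq'] _.
have [qq'|qq'|qq'] := ltngtP q q'; subst k k'; last by subst q'; lia.
- have : (q.+1 * r j <= q' * r j)%N by rewrite leq_mul2r qq' orbT.
  by rewrite mulSn; lia.
- have : (q'.+1 * r j <= q * r j)%N by rewrite leq_mul2r qq' orbT.
  by rewrite mulSn; lia.
Qed.

Definition lamp_at (m : int) : wreath :=
  (fun j u z => lamp_gen u (z - m)%R, 0%R).
Definition shift (n : int) : wreath := (fun j u z => 1, n).

Lemma shiftD m n : shift (m + n)%R = shift m * shift n.
Proof. by apply: wreath_eq => [j u z|] //=; rewrite mulg1. Qed.

Lemma shift_lamp n m : shift n * lamp_at m = lamp_at (m + n)%R * shift n.
Proof.
apply: wreath_eq => [j u z|] /=; last by rewrite addrC.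
by rewrite mul1g mulg1; congr lamp_gen; lia.
Qed.

Lemma lamp_atV m : (lamp_at m)^-1 = lamp_at m.
Proof.
apply: wreath_eq => [j u z|] //=; rewrite addr0.
by apply: (mulgI (lamp_gen u (z - m)%R)); rewrite mulgV lamp_gen_sq.
Qed.

Definition lamps (l : seq int) : wreath := \prod_(m <- l) lamp_at m.

Lemma lamps_cat l l' : lamps (l ++ l') = lamps l * lamps l'.
Proof. exact: big_cat. Qed.

Lemma lampsV l : (lamps l)^-1 = lamps (rev l).
Proof.
elim: l => [|m l IHl]; first by rewrite /lamps big_nil invg1.
rewrite rev_cons -cats1 lamps_cat -IHl /lamps big_cons invgM big_seq1.
by rewrite lamp_atV.
Qed.

Lemma shift_lamps n l :
  shift n * lamps l = lamps [seq (m + n)%R | m <- l] * shift n.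
Proof.
elim: l => [|m l IHl]; first by rewrite /lamps !big_nil mulg1 mul1g.
by rewrite /lamps !big_cons mulgA shift_lamp -mulgA IHl mulgA.
Qed.

Lemma lamps_shift2 l : (lamps l).2 = 0%R.
Proof.
by elim: l => [|m l IHl]; rewrite /lamps ?big_nil// big_cons /= add0r.
Qed.

Lemma lamps1 l j (u : U j) z :
  (lamps l).1 j u z = \prod_(m <- l) lamp_gen u (z - m)%R.
Proof.
elim: l => [|m l IHl]; first by rewrite /lamps !big_nil.
by rewrite /lamps !big_cons wreath_lampM subr0 IHl.
Qed.

Definition near (M : nat) : pred int := fun m => (`|m| <= M)%N.

(** At [z] only the occurrences of [m] are lit, and the letter there is an involution, so their
    parity decides. *)
Lemma lamps_sparse M l j (u : U j) z m : (2 * M < r j)%N -> all (near M) l ->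
  near M m -> lamp_gen u (z - m)%R != 1 ->
  (lamps l).1 j u z = lamp_gen u (z - m)%R ^+ odd (count_mem m l).
Proof.
move=> Mr + mM nm; rewrite lamps1.
elim: l => [|m' l IHl]; first by rewrite big_nil.
move=> /= /andP[mM' /IHl{}IHl]; rewrite big_cons {}IHl oddD.
have [->|nmm'] := eqVneq m' m.
  by rewrite addbC; case: (odd _); rewrite /= ?expg1 ?mulg1// lamp_gen_sq.
suff -> : lamp_gen u (z - m')%R = 1 by rewrite mul1g.
apply/eqP; apply: contraNT nmm' => nm'; apply/eqP.
exact: (lamp_gen_sparse Mr mM' mM nm').
Qed.

Lemma lamps_trivial M l j (u : U j) z : all (near M) l ->
  (forall m, near M m -> lamp_gen u (z - m)%R = 1) -> (lamps l).1 j u z = 1.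
Proof.
move=> + triv; rewrite lamps1.
elim: l => [|m l IHl] /=; first by rewrite big_nil.
by move=> /andP[mM /IHl]; rewrite big_cons triv// mul1g.
Qed.

(** At each position both values are powers of one and the same letter. *)
Lemma lamps_commute M l l' j (u : U j) z : (2 * M < r j)%N ->
  all (near M) l -> all (near M) l' ->
  commute ((lamps l).1 j u z) ((lamps l').1 j u z).
Proof.
move=> Mr lM l'M.
have [[m mM nm]|triv] := pselect
  (exists2 m, near M m & lamp_gen u (z - m)%R != 1).
  by rewrite /commute !(lamps_sparse Mr _ mM nm)// -!expgnDr addnC.
rewrite /commute !(lamps_trivial (M := M))// => m mM;
by apply: contra_notP triv => /eqP; exists m.
Qed.

Lemma lamps_bounded M l j (u : U j) z : all (near M) l ->
  (lamps l).1 j u z != 1 -> (`|z| <= M + 2 ^ j * r j)%N.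
Proof.
move=> lM; apply: contraNT => zb; apply/eqP; apply: (lamps_trivial lM) => m mM.
apply/eqP; apply: contraNT zb => /lamp_gen_bounded/andP[z0 zm].
by move: mM z0 zm; rewrite /near; lia.
Qed.

(** * Finiteness of the balls of lamps *)

Hypothesis r_unbounded :
  forall M, exists J, forall j, (J <= j)%N -> (M < r j)%N.

(** Finite data determine the product: its values on a window at the levels below [J], and the
    parities of the lamps, which suffice at the sparse levels from [J] on. *)
Lemma lamps_finite M :
  finite_set [set x | exists2 l, all (near M) l & x = lamps l].
Proof.
have [J rJ] := r_unbounded (2 * M).
(* Outside [[-N, N]] all levels below [J] are trivial, by [lamps_bounded]. *)
pose N := (\sum_(j < J) (M + 2 ^ j * r j))%N.
(* The ordinals, shifted by [M] and [N], code the integers of [[-M, M]] and [[-N, N]]. *)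
pose key (l : seq int) : {ffun 'I_(M.*2.+1) -> bool} *
    {dffun forall j : 'I_J, {ffun U j * 'I_(N.*2.+1) -> H j}} :=
  ([ffun i : 'I_(M.*2.+1) => odd (count_mem ((i : nat)%:Z - M%:Z)%R l)],
   [ffun j : 'I_J => [ffun uz : U j * 'I_(N.*2.+1) =>
     (lamps l).1 j uz.1 ((uz.2 : nat)%:Z - N%:Z)%R]]).
have keyP l l' : all (near M) l -> all (near M) l' -> key l = key l' ->
    lamps l = lamps l'.
  move=> lM l'M [/ffunP kc /ffunP kv].
  apply: wreath_eq => [j u z|]; last by rewrite !lamps_shift2.
  have [jJ|/rJ Mr] := ltnP j J.
    have [zN|zN] := leqP `|z| N.
      have zb : (absz (z + N%:Z)%R < N.*2.+1)%N by lia.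
      move/(_ (Ordinal jJ))/ffunP/(_ (u, Ordinal zb)) : kv.
      by rewrite !ffunE /= (_ : _ - _ = z)%R//; lia.
    have jN : (M + 2 ^ j * r j <= N)%N.
      by rewrite /N (bigD1 (Ordinal jJ))//= leq_addr.
    have big0 l0 : all (near M) l0 -> (lamps l0).1 j u z = 1.
      move=> l0M; apply/eqP; apply: contraLR zN => /(lamps_bounded l0M) zN.
      by rewrite -leqNgt (leq_trans zN).
    by rewrite !big0.
  have [[m mM nm]|triv] := pselect
  (exists2 m, near M m & lamp_gen u (z - m)%R != 1).
    rewrite !(lamps_sparse Mr _ mM nm)//; congr (_ ^+ _).
    have mb : (absz (m + M%:Z)%R < M.*2.+1)%N by move: mM; rewrite /near; lia.
    move/(_ (Ordinal mb)) : kc; rewrite !ffunE /= (_ : _ - _ = m)%R => [->//|].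
    by move: mM; rewrite /near; lia.
  rewrite !(lamps_trivial (M := M))// => m mM;
  by apply: contra_notP triv => /eqP; exists m.
(* By [keyP], [g] recovers [lamps l] from its key, so the set lies in the range of a map on a finite
   type. *)
pose g t := xget 1
  [set x | exists l, [/\ all (near M) l, key l = t & x = lamps l]].
apply: (@sub_finite_set _ _ (range g)); last exact/finite_image/finite_finset.
move=> x [l lM ->]; exists (key l) => //; rewrite /g.
case: xgetP => [y _ [l' [l'M kl' ->]]|/(_ (lamps l))[]]; first exact: keyP.
by exists l.
Qed.

(** * The lamplighter subgroup and its elementary amenability *)

Lemma shiftN n : (shift n)^-1 = shift (- n)%R.
Proof. by apply: wreath_eq => [j u z|] //=; rewrite invg1. Qed.

Lemma lamps_group M :
  group_closed (fun x => `[< exists2 l, all (near M) l & x = lamps l >]).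
Proof.
split=> [|x y /asboolP[l lM ->] /asboolP[l' lM' ->]]; apply/asboolP.
  by exists [::]; rewrite // /lamps big_nil.
by exists (l ++ rev l'); rewrite ?lamps_cat ?lampsV// all_cat all_rev lM.
Qed.

Lemma all_lamps_group : group_closed (fun x => `[< exists l, x = lamps l >]).
Proof.
split=> [|x y /asboolP[l ->] /asboolP[l' ->]]; apply/asboolP.
  by exists [::]; rewrite // /lamps big_nil.
by exists (l ++ rev l'); rewrite ?lamps_cat ?lampsV.
Qed.

Lemma lamplighter_group :
  group_closed (fun x => `[< exists l n, x = lamps l * shift n >]).
Proof.
split=> [|x y /asboolP[l [n ->]] /asboolP[l' [n' ->]]]; apply/asboolP.
  by exists [::], 0%R; rewrite /lamps big_nil mul1g.
exists (l ++ [seq (m + (n - n'))%R | m <- rev l']), (n - n')%R.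
rewrite lamps_cat invgM lampsV shiftN mulgA -(mulgA (lamps l)) -shiftD.
by rewrite -mulgA shift_lamps mulgA.
Qed.

Definition ball_sg M := Subgroup (lamps_group M).
Definition base_sg := Subgroup all_lamps_group.
Definition lamplighter_sg := Subgroup lamplighter_group.
Definition lamplighter : groupType := sg_type lamplighter_sg.

(** The base is the increasing union of the finite groups [ball_sg M]. *)
Lemma EA_base : elementary_amenable (sg_type base_sg).
Proof.
apply: (@EA_directed_union _ ball_sg).
- by move=> n x [l _ ->]; exists l.
- move=> x [l ->]; exists (\sum_(m <- l) `|m|)%N, l => //.
  by apply/allP => m ml; rewrite /near (big_rem m)//= leq_addr.
- move=> m n mn x [l lM ->]; exists l => //.
  by apply: sub_all lM => i /leq_trans; exact.
by move=> n; apply: EA_finite_subgroup; exact: lamps_finite.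
Qed.

Lemma base_lamplighter x : base_sg x -> lamplighter_sg x.
Proof. by move=> [l ->]; exists l, 0%R; rewrite (_ : shift 0 = 1) ?mulg1. Qed.

Definition lamplighter_shift (x : lamplighter) : zgroup := (val x).2.

Lemma lamplighter_shiftM : {morph lamplighter_shift : x y / x * y}.
Proof. by []. Qed.

(** The shift coordinate maps onto the integers with kernel the base. *)
Lemma EA_lamplighter : elementary_amenable lamplighter.
Proof.
apply: (@EA_extension _ _ _ (mk_mult (sg_inclM base_lamplighter))
  (mk_mult lamplighter_shiftM)) EA_base EA_zgroup.
- exact: sg_incl_inj.
- move=> n; have nP : lamplighter_sg (shift n).
    by exists [::], n; rewrite /lamps big_nil mul1g.
  by exists (sg_sub nP).
- move=> x; have [l [n xE]] := sg_valP x; split => [xn|[y <-]]; last first.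
    have [l' yE] := sg_valP y.
    by rewrite /= /lamplighter_shift /= yE lamps_shift2.
  have bl : base_sg (lamps l) by exists l.
  exists (sg_sub bl); apply/val_inj => /=; rewrite xE.
  move: xn; rewrite /= /lamplighter_shift xE /= lamps_shift2 add0r => ->.
  by rewrite (_ : shift 0 = 1) ?mulg1.
Qed.

(** * Words in the two generators *)

Definition wreath_gens : set wreath := [set lamp_at 0; shift 1].

Lemma wreath_gensE x : wreath_gens x \/ wreath_gens x^-1 ->
  [\/ x = lamp_at 0, x = shift 1 | x = shift (-1)].
Proof.
case=> -[]; first by constructor 1.
- by constructor 2.
- by move=> xV; constructor 1; rewrite -(invgK x) xV lamp_atV.
- by move=> xV; constructor 3; rewrite -(invgK x) xV shiftN.
Qed.

(** Prepending a generator adds a lamp at 0 or translates the lamps by one, so they stay within the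
    length of the word. *)
Lemma word_lamps s : word_on wreath_gens s -> exists l n,
  all (near (size s)) l /\ \prod_(x <- s) x = lamps l * shift n.
Proof.
elim: s => [_|x s IHs xsS].
  by exists [::], 0%R; rewrite /lamps !big_nil mul1g.
have [y ys|l [n [lM sE]]] := IHs _; first by apply: xsS; rewrite inE ys orbT.
have nearS l' (e : int) : (`|e| <= 1)%N -> all (near (size s)) l' ->
    all (near (size s).+1) [seq (m + e)%R | m <- l'].
  move=> e1 /allP l'M; apply/allP => _ /mapP[m /l'M mM ->].
  by move: mM; rewrite /near; lia.
rewrite big_cons sE.
have /wreath_gensE[->|->|->] := xsS x (mem_head _ _).
- exists (0%R :: l), n; rewrite /lamps big_cons mulgA; split => //=.
  by apply: sub_all lM => m; rewrite /near /=; lia.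
- exists [seq (m + 1)%R | m <- l], (1 + n)%R.
  by rewrite mulgA shift_lamps -mulgA -shiftD; split => //; exact: nearS.
- exists [seq (m + -1)%R | m <- l], (-1 + n)%R.
  by rewrite mulgA shift_lamps -mulgA -shiftD; split => //; exact: nearS.
Qed.

(** * Vanishing of the law on short words *)

Lemma base_expg (x : wreath) n j (u : U j) z : x.2 = 0%R ->
  (x ^+ n).1 j u z = x.1 j u z ^+ n.
Proof.
move=> x2; elim: n => [|n IHn]; first by rewrite !expg0.
by rewrite !expgS wreath_lampM x2 subr0 IHn.
Qed.

(** An abstraction of the unitriangular elements of [H j]: all lamp values lie there, and there the
    exponent bound holds. *)
Variable good : forall j, H j -> Prop.
Hypothesis good1 : forall j, good (1 : H j).
Hypothesis goodM : forall j (g h : H j), good g -> good h -> good (g * h).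
Hypothesis good_gen : forall j (u : U j) i, good (gen u i).
Hypothesis good_exp : forall j (h : H j), good h -> h ^+ (2 ^ j) = 1.

Lemma good_lamps l j (u : U j) z : good ((lamps l).1 j u z).
Proof.
rewrite lamps1; elim/big_ind : _ => [||m _]; [exact: good1|exact: goodM|].
by case: (_ - _)%R => [i|i] /=; [case: ifP => _|]; rewrite ?good1// good_gen.
Qed.

(** Up to level [J] the exponent kills the power; beyond it the two inner commutators commute. *)
Lemma law_vanish s s' J :
  word_on wreath_gens s -> word_on wreath_gens s' ->
  (forall j, (J < j)%N -> (4 * (size s + size s') < r j)%N) ->
  comm2 (\prod_(x <- s) x) (\prod_(x <- s') x) ^+ (2 ^ J) = 1.
Proof.
(* [M] is the length of the words spelling the inner commutators, whose shifts cancel; they are thus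
   products of lamps within distance [M]. *)
move=> sS s'S Jr; set M := (2 * (size s + size s'))%N.
have size_inv (t : seq wreath) : size (inv_word t) = size t.
  by rewrite size_map size_rev.
have base_word t : word_on wreath_gens t -> size t = M ->
    (\prod_(x <- t) x).2 = 0%R ->
    exists2 l, all (near M) l & \prod_(x <- t) x = lamps l.
  move=> /word_lamps[l [n [lM ->]]] <-.
  rewrite wreath_shiftM lamps_shift2 add0r => n0; exists l => //.
  by rewrite (_ : shift n = 1) ?mulg1// /shift (_ : n = 0%R).
set x := \prod_(_ <- s) _; set y := \prod_(_ <- s') _.
have [|||lc lcM cE] := base_word (s ++ s' ++ inv_word s ++ inv_word s').
- by do !apply: word_on_cat => //; exact: word_on_inv.
- by rewrite !size_cat !size_inv /M mul2n -addnn addnA.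
- rewrite !big_cat !prod_inv_word !wreath_shiftM !wreath_shiftV.
  by rewrite addrA -opprD subrr.
have [|||ld ldM dE] := base_word (inv_word s ++ inv_word s' ++ s ++ s').
- by do !apply: word_on_cat => //; exact: word_on_inv.
- by rewrite !size_cat !size_inv /M mul2n -addnn addnA.
- rewrite !big_cat !prod_inv_word !wreath_shiftM !wreath_shiftV.
  by rewrite addrA -opprD addNr.
have -> : comm2 x y = lamps lc * lamps ld * (lamps lc)^-1 * (lamps ld)^-1.
  by rewrite -cE -dE !big_cat !prod_inv_word /= /comm2 !mulgA.
rewrite !lampsV -!lamps_cat.
set l := (_ ++ rev ld).
apply: wreath_eq => [j u z|]; last first.
  by elim: (2 ^ J)%N => // n IHn; rewrite expgS wreath_shiftM IHn lamps_shift2.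
rewrite base_expg ?lamps_shift2//.
have [jJ|Jj] := leqP j J.
  rewrite -(subnKC jJ) expnD expgM good_exp ?expg1n//; exact: good_lamps.
suff -> : (lamps l).1 j u z = 1 by rewrite expg1n.
have Mr : (2 * M < r j)%N by rewrite /M mulnA; exact: Jr.
rewrite /l !lamps_cat !wreath_lampM !lamps_shift2 !subr0 -!lampsV.
rewrite (lamps_commute _ _ Mr lcM ldM) !wreath_shiftM wreath_shiftV.
by rewrite !lamps_shift2 /= !lamps_shift2 !addr0 mulgK mulgV.
Qed.

(** * Finite generation *)

Definition lamplighter_gens : set lamplighter :=
  [set g | wreath_gens (val g)].

Lemma finite_gens : finite_set lamplighter_gens.
Proof.
apply: (@finite_preimage _ _ wreath_gens (val : lamplighter -> wreath)).
  by move=> x y _ _; exact: val_inj.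
by rewrite /wreath_gens; exact: finite_set2.
Qed.

Lemma lamp_at_in m : lamplighter_sg (lamp_at m).
Proof.
by exists [:: m], 0%R; rewrite /lamps big_seq1 (_ : shift 0 = 1) ?mulg1.
Qed.

Lemma shift_in n : lamplighter_sg (shift n).
Proof. by exists [::], n; rewrite /lamps big_nil mul1g. Qed.

Definition glamp m : lamplighter := sg_sub (lamp_at_in m).
Definition gshift n : lamplighter := sg_sub (shift_in n).

Lemma gshift_word n : exists s, [/\ word_on lamplighter_gens s,
  size s = `|n|%N & \prod_(x <- s) x = gshift n].
Proof.
have word (e : int) (k : nat) : lamplighter_gens (gshift e) \/
    lamplighter_gens (gshift e)^-1 -> exists s, [/\ word_on lamplighter_gens s,
    size s = k & \prod_(x <- s) x = gshift (e * k%:Z)%R].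
  move=> eS; exists (nseq k (gshift e)); split.
  - by move=> x /nseqP[->].
  - exact: size_nseq.
  - elim: k => [|k IHk]; apply/val_inj.
      by rewrite big_nil mulr0.
    by rewrite big_cons IHk /= -shiftD; congr shift; lia.
case: n => n.
- have [|s [sS sn sE]] := word 1%R n; first by left; right.
  by exists s; split => //; rewrite sE mul1r.
- have [|s [sS sn sE]] := word (-1)%R n.+1.
    by right; right; rewrite /= shiftN opprK.
  by exists s; split => //; rewrite sE; congr gshift; lia.
Qed.

(** The lamp at [m] is the conjugate of the lamp at 0 by the shift by [m]. *)
Lemma glamp_word m : exists s, [/\ word_on lamplighter_gens s,
  size s = (2 * `|m|).+1 & \prod_(x <- s) x = glamp m].
Proof.
have [s [sS sm sE]] := gshift_word m.
exists (s ++ glamp 0 :: inv_word s); split.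
- apply: word_on_cat => // x; rewrite inE => /predU1P[->|]; first by left; left.
  by move: x; exact: word_on_inv.
- by rewrite size_cat /= size_map size_rev sm; lia.
- rewrite big_cat big_cons prod_inv_word sE /=; apply/val_inj => /=.
  by rewrite mulgA shift_lamp add0r mulgK.
Qed.

Lemma gens_generate : generates lamplighter_gens.
Proof.
move=> g; have [l [n gE]] := sg_valP g.
elim: l g gE => [|m l IHl] g gE.
  have [s [sS _ sE]] := gshift_word n; exists s => //.
  by rewrite sE; apply/val_inj; rewrite gE /lamps big_nil mul1g.
have [|s sS sE] := IHl ((glamp m)^-1 * g).
  by rewrite /= gE /lamps big_cons -mulgA mulKg.
have [s' [s'S _ s'E]] := glamp_word m.
exists (s' ++ s); first exact: word_on_cat.
by rewrite big_cat /= s'E sE mulVKg.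
Qed.

(** * Upper bound on the complexity *)

Hypothesis gen_separates : forall j (s : seq nat), s != [::] ->
  (size s < 2 ^ j)%N -> all (fun i => (i < 2 ^ j)%N) s ->
  sorted (fun p q => p != q) s ->
  exists u : U j, \prod_(i <- s) gen u i != 1.

Section Detect.
Variables (k j : nat).

(** Embeds the free group in a free product of groups of order 2: the generator of index [i] goes to
    the product of the involutions [2i] and [2i + 1], its inverse to the reversed product. *)
Definition letter_code (x : letter k) : seq nat :=
  [:: (x.1.*2 + x.2)%N; (x.1.*2 + ~~ x.2)%N].

(** Translation by [-(p * r j)] brings letter [p] of level [j] to position 0, where this element
    therefore shows the code of the generator [i]. *)
Definition witness (i : 'I_k) : lamplighter :=
  glamp (- (i.*2 * r j)%N%:Z)%R * glamp (- (i.*2.+1 * r j)%N%:Z)%R.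

(** Adjacent codes repeat a letter at their seam only if the second letter is the flip of the
    first. *)
Lemma sorted_code (s : seq (letter k)) : reduced s ->
  sorted (fun p q => p != q) (flatten (map letter_code s)).
Proof.
elim: s => [//|x s IHs] xs; have {IHs} := IHs (path_sorted xs).
case: x s xs => [i b] [|[i' b'] s] /=; first by case: b => /=; lia.
rewrite /flip /= => /andP[+ _] => + -> => ne; rewrite andbT.
apply/andP; split; first by case: (b); lia.
apply: contra ne => /eqP e; rewrite xpair_eqE -val_eqE /=.
by case: b b' e => -[] /=; lia.
Qed.

Lemma witness_letter (x : letter k) : val (letter_eval witness x) =
  lamps [seq (- (i * r j)%N%:Z)%R | i <- letter_code x].
Proof.
case: x => i [] /=; rewrite /letter_eval /= /lamps !big_cons big_nil mulg1.
  by rewrite invgM !lamp_atV addn0 addn1.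
by rewrite addn0 addn1.
Qed.

Lemma witness_eval (w : free_group k) : val (free_eval witness w) =
  lamps [seq (- (i * r j)%N%:Z)%R | i <- flatten (map letter_code (val w))].
Proof.
rewrite /free_eval; elim: (val w) => [|x s IHs].
  by rewrite /lamps !big_nil.
have -> : flatten (map letter_code (x :: s)) =
  letter_code x ++ flatten (map letter_code s) by [].
by rewrite big_cons map_cat lamps_cat -IHs -witness_letter.
Qed.

Lemma witness_neq1 (w : free_group k) : w != 1 -> (2 * k < 2 ^ j)%N ->
  (2 * free_length w < 2 ^ j)%N -> free_eval witness w != 1.
Proof.
move=> w1 kj wj.
have [||||u] := @gen_separates j (flatten (map letter_code (val w))).
- apply: contra w1 => /eqP; case E : (val w) => // _.
  by apply/eqP/val_inj; rewrite E.
- rewrite (leq_ltn_trans _ wj)// /free_length.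
  by elim: (val w) => //= x s IHs; rewrite mulnS add2n !ltnS.
- have code_lt (a : nat) (b : bool) : (a < k)%N -> (a.*2 + b < 2 ^ j)%N.
    by move: kj; case: b; lia.
  apply/allP => p /flattenP[_ /mapP[x _ ->]].
  by rewrite !inE => /orP[] /eqP->; exact: code_lt.
- exact: sorted_code (valP w).
apply: contra => /eqP w0; have := congr1 val w0; rewrite witness_eval.
(* At level [j], parameter [u] and position 0 the value of [w] is the product of the coded letters,
   which [u] separates from 1. *)
move=> /(congr1 (fun x : wreath => x.1 j u 0%R)); rewrite lamps1 big_map => e.
rewrite -[X in _ == X]e; apply/eqP; apply: eq_bigr => i _.
by rewrite sub0r opprK lamp_gen_mul.
Qed.

Lemma witness_cost :
  (\sum_(i < k) word_length lamplighter_gens (witness i) <= 10 * k ^ 2 * r j)%N.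
Proof.
apply: (@leq_trans (\sum_(i < k) 10 * k * r j)%N); last first.
  by rewrite sum_nat_const card_ord; nia.
(* The two lamps cost [(8 * i + 2) * r j + 2] together, at most [10 * k * r j]. *)
apply: leq_sum => i _; have ik := ltn_ord i; have rj := r_gt0 j.
have [s [sS sl sE]] := glamp_word (- (i.*2 * r j)%N%:Z)%R.
have [s' [s'S s'l s'E]] := glamp_word (- (i.*2.+1 * r j)%N%:Z)%R.
rewrite /witness -sE -s'E -big_cat /=.
apply: leq_trans (word_length_le (word_on_cat sS s'S)) _.
by rewrite size_cat sl s'l !abszN !absz_nat; nia.
Qed.

Lemma complexity_le (w : free_group k) : w != 1 -> (2 * k < 2 ^ j)%N ->
  (2 * free_length w < 2 ^ j)%N ->
  (complexity lamplighter_gens w <= 10 * k ^ 2 * r j)%N.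
Proof.
move=> w1 kj wj; apply: leq_trans witness_cost; apply: (nat_minP _).2.
by exists witness => //; exact: witness_neq1.
Qed.

End Detect.

Lemma not_law k (w : free_group k) : w != 1 -> exists g : 'I_k -> lamplighter,
  free_eval g w != 1.
Proof.
move=> w1; exists (@witness k (2 * k + 2 * free_length w)).
have pow n : (n < 2 ^ n)%N by exact: ltn_expl.
by apply: witness_neq1 => //; apply: leq_ltn_trans (pow _);
  rewrite ?leq_addr ?leq_addl.
Qed.

Lemma lawless_lamplighter : lawless lamplighter.
Proof.
by exists 2%N => // w /not_law[g /eqP gw] /(_ g).
Qed.

(** * Lower bound on the complexity *)

Hypothesis r_mono : forall i j, (i <= j)%N -> (r i <= r j)%N.

(** A cheaper tuple would have entries short enough for [law_vanish] at every level beyond [J]. *)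
Lemma law_complexity k (i0 i1 : 'I_k) (i01 : i0 != i1) J :
  (r J.+1 <= 4 * complexity lamplighter_gens (law_word i01 (2 ^ J)))%N.
Proof.
have w1 : law_word i01 (2 ^ J) != 1 by rewrite law_word_neq1// expn_gt0.
have [g0 g0w] := not_law w1.
rewrite leqNgt; apply/negP => small.
(* The tuple [g0] makes the set nonempty, so its minimum is attained, by [g]. *)
have [|[g gw gE] _] := @nat_minP
  [set (\sum_(i < k) word_length lamplighter_gens (g i))%N |
     g in [set g : 'I_k -> lamplighter |
       free_eval g (law_word i01 (2 ^ J)) != 1]]
  (\sum_(i < k) word_length lamplighter_gens (g0 i)).
  by exists g0.
rewrite -[nat_min _]/(complexity _ _) in gE; rewrite -{}gE in small.
case/negP: gw; apply/eqP/val_inj; rewrite law_word_eval.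
have [s0 [s0S s0E s0l]] := word_lengthP (g i0) gens_generate.
have [s1 [s1S s1E s1l]] := word_lengthP (g i1) gens_generate.
have valS (s : seq lamplighter) : word_on lamplighter_gens s ->
    word_on wreath_gens (map val s).
  by move=> sS _ /mapP[x /sS xS ->].
have valE (s : seq lamplighter) :
    val (\prod_(x <- s) x) = \prod_(x <- map val s) x.
  by rewrite big_map; elim: s => [|x s IHs]; rewrite ?big_nil// !big_cons -IHs.
have valX (x : lamplighter) n : val (x ^+ n) = val x ^+ n.
  by elim: n => // n IHn; rewrite !expgS -IHn.
rewrite valX [val _](_ : _ = comm2 (val (g i0)) (val (g i1)))//.
rewrite -s0E -s1E !valE; apply: law_vanish; [exact: valS|exact: valS|].
move=> j Jj; apply: leq_trans (r_mono Jj); rewrite !size_map s0l s1l.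
apply: leq_ltn_trans small; rewrite leq_mul2l /= (bigD1 i0)//= leq_add2l.
by rewrite (bigD1 i1) 1?eq_sym//= leq_addr.
Qed.

End Wreath.

(** * The lamp groups *)

Section Levels.
Variable j : nat.

Definition level_dim : nat := (2 ^ j).-1.
Definition level_group : finGroupType := {unit 'M['F_2]_level_dim.+1}.
(* Words in the letters [0, ..., level_dim]; the value [level_dim.+1] pads
   short words. *)
Definition level_index : finType :=
  {ffun 'I_level_dim.+1 -> 'I_level_dim.+2}.
Implicit Types (u : level_index) (h : level_group).

Definition level_mx u (i : nat) : 'M['F_2]_level_dim.+1 :=
  letter_mx (fun b => u b) i.

Lemma level_mx_unit u i : level_mx u i \is a GRing.unit.
Proof. by apply/unitrP; exists (level_mx u i); rewrite letter_mx_sq. Qed.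

Definition level_letter u i : level_group := FinRing.Unit (level_mx_unit u i).

Lemma level_dimS : level_dim.+1 = (2 ^ j)%N.
Proof. by rewrite prednK ?expn_gt0. Qed.

Lemma level_letter_sq u i : level_letter u i * level_letter u i = 1.
Proof. by apply/val_inj; rewrite FinRing.val_unitM letter_mx_sq. Qed.

(** The values of [u] do not exceed [level_dim.+1 = 2 ^ j]. *)
Lemma level_letter_large u i : (2 ^ j < i)%N -> level_letter u i = 1.
Proof.
rewrite -level_dimS => ji; apply/val_inj; rewrite /= /level_mx /letter_mx.
rewrite (_ : letter_nil _ _ = 0%R) ?addr0//; apply/matrixP => a b.
rewrite !mxE; have := ltn_ord (u b).
by case: (u b =P i :> nat) => [->|_ _]; [lia|rewrite andbF].
Qed.

Lemma level_exp h : unitri (val h) -> h ^+ (2 ^ j) = 1.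
Proof.
move=> uh; apply/val_inj; rewrite FinRing.val_unitX unitri_exp//.
by rewrite -level_dimS.
Qed.

Lemma level_prod u (s : seq nat) :
  val (\prod_(i <- s) level_letter u i) = (\prod_(i <- s) level_mx u i)%R.
Proof.
elim: s => [|i s IHs]; first by rewrite !big_nil.
by rewrite !big_cons FinRing.val_unitM IHs.
Qed.

Lemma level_separates (s : seq nat) : s != [::] -> (size s < 2 ^ j)%N ->
  all (fun i => (i < 2 ^ j)%N) s -> sorted (fun p q => p != q) s ->
  exists u, \prod_(i <- s) level_letter u i != 1.
Proof.
rewrite -level_dimS => s0 sj /allP sS sorts.
have nth_lt b : (nth level_dim.+1 (rev s) b < level_dim.+2)%N.
  have [bs|bs] := ltnP b (size s); last by rewrite nth_default ?size_rev.
  by rewrite ltnW// ltnS sS// -mem_rev mem_nth// size_rev.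
(* [u] spells [s] backwards; the padding from row [size s] on lies outside the alphabet, hence
   differs from the head of [s]. The entry in row [size s], column 0 is then 1, against 0 in the
   identity. *)
exists [ffun b : 'I_level_dim.+1 => Ordinal (nth_lt b)].
apply/eqP => /(congr1 val); rewrite level_prod => /matrixP.
move=> /(_ (Ordinal sj) ord0); rewrite prod_letter_entry //=; last first.
- move=> b bs; rewrite ffunE /= nth_default ?size_rev ?bs//.
  case: (s) s0 sS => //= i t _ /(_ i (mem_head _ _)) il.
  by rewrite gtn_eqF.
- by move=> b bs; rewrite ffunE /= (set_nth_default 0%N)// size_rev.
by rewrite mxE eqxx -val_eqE /= size_eq0 (negPf s0).
Qed.

End Levels.

(* The two growth comparisons *)
Local Close Scope group_scope.

Theorem theorem1p2 (f : nat -> nat)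
  (f_pos : set_fun posn posn f)
  (f_surj : set_surj posn posn f)
  (f_unbounded : ~ has_ubound (f @` posn))
  (f_nondecreasing :
     forall m n : nat, (0 < m)%N -> (m <= n)%N -> (f m <= f n)%N)
  (f_growth : exists2 M : nat, (2 <= M)%N &
     forall n : nat, (0 < n)%N -> (f (M * n) <= M * f n)%N) :
  exists (Gamma : groupType) (S : set Gamma),
    [/\ elementary_amenable Gamma,
        lawless Gamma,
        finite_set S,
        generates S
      & forall k : nat, (2 <= k)%N ->
          growth_equiv (lawlessness_growth S k) f].
Proof.
pose r j := f (2 ^ j).
have pow_gt0 j : (0 < 2 ^ j)%N by rewrite expn_gt0.
have r_gt0 j : (0 < r j)%N by exact: (f_pos _ (pow_gt0 j)).
have r_mono i j : (i <= j)%N -> (r i <= r j)%N.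
  by move=> ij; apply: f_nondecreasing => //; rewrite leq_pexp2l.
have r_unbounded M : exists J, forall j, (J <= j)%N -> (M < r j)%N.
  apply: contra_notP f_unbounded => bounded.
  exists M => _ [n n0 <-]; rewrite leEnat leqNgt; apply/negP => Mn.
  apply: bounded; exists n => j nj; apply: leq_trans Mn _.
  by apply: f_nondecreasing => //; rewrite ltnW// (leq_ltn_trans nj)// ltn_expl.
pose Gamma := lamplighter r level_letter_sq.
pose S : set Gamma := @lamplighter_gens _ _ _ r level_letter_sq.
have growth_bound k l (w : free_group k) : (0 < k)%N -> (0 < l)%N -> w != 1%g ->
    (free_length w <= l)%N ->
    (complexity S w <= 10 * k ^ 2 * f (10 * k ^ 2 * l))%N.
  (* Level [e.+1] is high enough, as [2 ^ e.+1] exceeds [2 * k * l]; and [2 ^ e.+1 <= 4 * k * l]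
     lies below [10 * k ^ 2 * l]. *)
  move=> k0 l0 w1 wl; set e := trunc_log 2 (2 * (k * l)).
  have kl0 : (0 < k * l)%N by rewrite muln_gt0 k0.
  have /andP[le_e lt_e] : (2 ^ e <= 2 * (k * l) < 2 ^ e.+1)%N.
    by apply: trunc_log_bounds; rewrite // muln_gt0.
  apply: leq_trans
    (complexity_le _ r_gt0 (@level_separates) w1 (j := e.+1) _ _) _.
  - by apply: leq_ltn_trans lt_e; rewrite leq_mul2l leq_pmulr.
  - by apply: leq_ltn_trans lt_e; rewrite leq_mul2l (leq_trans wl)// leq_pmull.
  - rewrite leq_mul2l; apply/orP; right; apply: f_nondecreasing => //.
    rewrite expnS; apply: (@leq_trans (4 * (k * l))%N); first by lia.
    by rewrite mulnA leq_mul2r; apply/orP; right; nia.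
exists Gamma, S; split.
- exact: EA_lamplighter level_letter_large r_unbounded.
- exact: lawless_lamplighter r_gt0 level_separates.
- exact: finite_gens.
- exact: gens_generate.
move=> k k2; have k0 : (0 < k)%N by exact: ltnW.
split.
  exists (10 * k ^ 2)%N => [|l l0]; first by rewrite muln_gt0 expn_gt0 k0.
  apply: nat_max_le => _ [w [w1 wl] <-]; exact: growth_bound.
(* With [2 ^ J <= l < 2 ^ J.+1], the law word has length [16 * 2 ^ J <= 16 * l], while
   [f l <= r J.+1] is at most 4 times its complexity. *)
exists 16%N => // l l0; pose J := trunc_log 2 l.
have /andP[le_J lt_J] : (2 ^ J <= l < 2 ^ J.+1)%N by exact: trunc_log_bounds.
pose i0 := Ordinal k0; pose i1 := Ordinal k2.
have i01 : i0 != i1 by [].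
pose w := law_word i01 (2 ^ J).
apply: (@leq_trans (4 * complexity S w)%N).
  apply: leq_trans (f_nondecreasing _ _ l0 (ltnW lt_J)) _.
  rewrite -/(r J.+1).
  apply: (@law_complexity _ _ _ r level_letter_sq r_gt0
    (fun j (h : level_group j) => unitri (val h))) => //.
  - by move=> j; exact: unitri1.
  - by move=> j g h; exact: unitriM.
  - by move=> j u i; exact: unitri_letter.
  - exact: level_exp.
  - exact: level_separates.
(* The upper bound on complexities ensures that the maximum exists and is not the junk value. *)
apply: leq_mul => //; apply: le_nat_max.
  move=> _ [w' [w'1 w'l] <-]; apply: growth_bound w'l => //.
  by rewrite muln_gt0.
exists w => //; split; first exact: law_word_neq1.
by rewrite law_word_length leq_mul2l le_J.
Qed.
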